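(* Let $\mathcal{T}$ be a plane full binary tree whose leaves, ordered from left to right, are identified with $\mathcal{L}=\{1,\ldots,n\}$, and let $TT_n$ be the plane train track tree with $n$ leaves, whose leaves are likewise identified with $\{1,\ldots,n\}$ from left to right. Then $2$ is a tensor network exponent for $TT_n$ in $\mathcal{T}$.
   Context: A full binary tree is a finite rooted tree in which every vertex has either exactly two children (a node) or none (a leaf); a plane tree specifies for each node a left and a right child, which determines a left-to-right order of the leaves. The train track tree $TT_n$ is the full binary tree with $n$ leaves in which every node has at least one leaf as a child; as a plane tree, the left child of each node has at least as many leaf descendants as the right child. For a vertex $v$, $D(v)$ is the set of leaves descending from $v$ (a leaf descends from itself). A dimension vector for a tree is a vector of positive integers indexed by its vertices. For a family $\mathbb{V}=(V_\ell)_{\ell\in\mathcal{L}}$ of vector spaces and a vector $g$ of positive reals indexed by the vertices of a tree $\mathcal{S}$, $\mathrm{TNS}(\mathcal{S},\mathbb{V},g)$ is the set of $t\in\bigotimes_{\ell\in\mathcal{L}}V_\ell$ such that for every vertex $v$ there is a subspace $U_v\subseteq\bigotimes_{\ell\in D(v)}V_\ell$ with $\dim U_v\le g_v$, $t\in U_{\mathrm{root}}$, and $U_v\subseteq U_{v_1}\otimes U_{v_2}$ for each node $v$ with children $v_1,v_2$. For trees $\mathcal{S},\mathcal{S}'$ on a common leaf set, a tensor network exponent for $\mathcal{S}$ in $\mathcal{S}'$ is a positive number $e$ such that for all dimension vectors $f$ of $\mathcal{S}$ and $f'$ of $\mathcal{S}'$ and all $c>e$ there is $r_0\in\mathbb{N}$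 with $\mathrm{TNS}(\mathcal{S},\mathbb{V},rf)\subseteq\mathrm{TNS}(\mathcal{S}',\mathbb{V},r^cf')$ for all families $\mathbb{V}$ and all $r\ge r_0$. *)

(* Defs.v *)
(* MathComp + MathComp-Analysis; [freeg] is taken from multinomials. *)
From HB Require Import structures.
From mathcomp Require Import all_boot all_order all_algebra ring_quotient.
From mathcomp Require Import boolp classical_sets reals exp freeg.

Set Implicit Arguments.
Unset Strict Implicit.
Unset Printing Implicit Defensive.

Import Order.TTheory GRing.Theory Num.Theory.
Local Open Scope classical_set_scope.
Local Open Scope ring_scope.
Local Open Scope quotient_scope.

Section Subspaces.
Variables (K : fieldType) (M : lmodType K).
Implicit Types (S U : set M).

Definition subspace U : Prop := submod_closed [in U].

Definition lspan S : set M := smallest subspace S.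

Definition lin_indep d (b : 'I_d -> M) : Prop :=
  forall c : 'I_d -> K, \sum_i c i *: b i = 0 -> forall i, c i = 0.

Definition has_dim U (d : nat) : Prop :=
  exists2 b : 'I_d -> M, lin_indep b & lspan (range b) = U.

(* [U] is finite-dimensional, of dimension at most the real number [g] *)
Definition dim_le (R : realType) U (g : R) : Prop :=
  exists2 d : nat, has_dim U d & d%:R <= g.

Lemma subspaceP U :
  subspace U <-> U 0 /\ forall a u v, U u -> U v -> U (a *: u + v).
Proof.
split=> [[/set_mem U0 UD]|[U0 UD]]; split=> //.
- by move=> a u v /mem_set Uu /mem_set Uv; apply/set_mem/UD.
- exact: mem_set.
- by move=> a u v /set_mem Uu /set_mem Uv; apply/mem_set/UD.
Qed.

Lemma lspan_subspace S : subspace (lspan S).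
Proof.
apply/subspaceP; split=> [U [/subspaceP[U0 _] _]//|a u v Su Sv U US].
by case: (US) => /subspaceP[_ UD] _; apply: UD; [apply: Su | apply: Sv].
Qed.

End Subspaces.

(* The tensor product of a finite family of vector spaces, of arbitrary       *)
(* dimension: the free vector space on the product set of the family, modulo  *)
(* the multilinearity relations.                                              *)
Section TensorProduct.
Variables (K : fieldType) (I : finType) (V : I -> lmodType K).

Definition vfam : Type := forall i, V i.
HB.instance Definition _ := Choice.on vfam.

Definition multilinear (W : lmodType K) (f : vfam -> W) : Prop :=
  forall (x : vfam) (i : I) (a : K) (u v : V i),
    f (dfwith x (a *: u + v)) = a *: f (dfwith x u) + f (dfwith x v).

Local Notation free := {freeg vfam / K}.

Definition multilin_rels : set free :=
  [set r | exists (x : vfam) (i : I) (a : K) (u v : V i),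
     r = << dfwith x (a *: u + v) >>
         - (a *: << dfwith x u >> + << dfwith x v >>)].

Definition tens_rel : {pred free} := [in lspan multilin_rels].

Lemma tens_rel_submod_closed : submod_closed tens_rel.
Proof. exact: lspan_subspace. Qed.

HB.instance Definition _ :=
  GRing.isSubmodClosed.Build K free tens_rel tens_rel_submod_closed.

Definition tens : Type := Quotient.quot tens_rel.
HB.instance Definition _ := GRing.Zmodule.on tens.
HB.instance Definition _ := EqQuotient.on tens.

Definition tens_scale (a : K) (t : tens) : tens := \pi_tens (a *: repr t).

Lemma tens_piP (x y : free) :
  \pi_tens x = \pi_tens y <-> lspan multilin_rels (x - y).
Proof.
split=> [/eqP|xy]; last first.
  by apply/eqP; rewrite -Quotient.idealrBE; apply/mem_set.
by rewrite -Quotient.idealrBE => /set_mem.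
Qed.

Lemma tens_piD : {morph \pi_tens : x y / x + y}.
Proof. by move=> x y; rewrite !piE. Qed.

Lemma tens_piZ a x : \pi_tens (a *: x) = tens_scale a (\pi_tens x).
Proof.
have /subspaceP[R0 RD] := lspan_subspace multilin_rels.
have : lspan multilin_rels (x - repr (\pi_tens x)).
  by apply/tens_piP; rewrite reprK.
by move=> /(RD a _ 0)/(_ R0); rewrite addr0 scalerBr => /tens_piP.
Qed.

Lemma tens_surj (t : tens) : exists x, t = \pi_tens x.
Proof. by exists (repr t); rewrite reprK. Qed.

Fact tens_scaleA a b t : tens_scale a (tens_scale b t) = tens_scale (a * b) t.
Proof. by have [x ->] := tens_surj t; rewrite -!tens_piZ scalerA. Qed.

Fact tens_scale1 : left_id 1 tens_scale.
Proof. by move=> t; have [x ->] := tens_surj t; rewrite -tens_piZ scale1r. Qed.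

Fact tens_scaleDr : right_distributive tens_scale +%R.
Proof.
move=> a t u; have [x ->] := tens_surj t; have [y ->] := tens_surj u.
by rewrite -tens_piD -!tens_piZ -tens_piD scalerDr.
Qed.

Fact tens_scaleDl t : {morph tens_scale^~ t : a b / a + b}.
Proof.
move=> a b; have [x ->] := tens_surj t.
by rewrite -!tens_piZ -tens_piD scalerDl.
Qed.

HB.instance Definition _ := GRing.Zmodule_isLmodule.Build K tens
  tens_scaleA tens_scale1 tens_scaleDr tens_scaleDl.

Definition tpure (x : vfam) : tens := \pi_tens << x >>.

Lemma tpure_multilinear : multilinear tpure.
Proof.
move=> x i a u v; rewrite /tpure.
rewrite -[a *: \pi_tens _]/(tens_scale a _) -tens_piZ -tens_piD.
apply/tens_piP.
by apply: sub_gen_smallest; exists x, i, a, u, v.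
Qed.

(* The linear map on the tensor product induced by [f]; as it is defined on   *)
(* representatives, it is meaningful only for multilinear [f] (see            *)
(* [tlift_pure] and [tlift_linear]).                                          *)
Definition tlift (W : lmodType K) (f : vfam -> W) (t : tens) : W :=
  fglift f (repr t).

Lemma freegZ a b x : a *: << b *g x >> = << (a * b) *g x >> :> free.
Proof. by apply/eqP/freeg_eqP => y; rewrite coeffZ !coeffU mulrA. Qed.

Lemma freeg_ind (P : free -> Prop) :
  P 0 -> (forall a x t, P t -> P (a *: << x >> + t)) -> forall t, P t.
Proof.
move=> P0 PS t; rewrite -[t]Freeg_enum; elim: (fgenum t) => [|[a x] s IHs].
  by rewrite freeg_nil.
rewrite -cat1s freeg_cat.
by rewrite -[a in << a *g _ >>]mulr1 -freegZ; apply: PS.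
Qed.

Lemma tens_ind (P : tens -> Prop) :
  P 0 -> (forall a x t, P t -> P (a *: tpure x + t)) -> forall t, P t.
Proof.
move=> P0 PS t; have [x ->] := tens_surj t; elim/freeg_ind: x => [|a x u Pu].
  suff -> : \pi_tens 0 = 0 by [].
  by apply: (addrI (\pi_tens 0)); rewrite -tens_piD !addr0.
by rewrite tens_piD tens_piZ; exact: PS.
Qed.

Section Lift.
Variables (W : lmodType K) (f : vfam -> W).

Lemma fglift_linear a s t :
  fglift f (a *: s + t) = a *: fglift f s + fglift f t.
Proof.
have fB := lift_is_additive f.
have f0 : fglift f 0 = 0 by rewrite -(subrr 0) fB subrr.
have fN u : fglift f (- u) = - fglift f u by rewrite -sub0r fB f0 sub0r.
have fD u v : fglift f (u + v) = fglift f u + fglift f v.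
  by rewrite -[v in LHS]opprK fB fN opprK.
rewrite fD; congr (_ + _).
elim/freeg_ind: s => [|b x s IHs]; first by rewrite scaler0 f0 scaler0.
have fU c : fglift f (c *: << x >>) = c *: f x by rewrite freegZ liftU mulr1.
by rewrite scalerDr !fD scalerDr IHs scalerA !fU scalerA.
Qed.

Hypothesis mf : multilinear f.

Lemma fglift_pi u : tlift f (\pi_tens u) = fglift f u.
Proof.
have : lspan multilin_rels (repr (\pi_tens u) - u).
  by apply/tens_piP; rewrite reprK.
pose Z : set free := [set t | fglift f t = 0].
have fB := lift_is_additive f.
have ZS : subspace Z.
  apply/subspaceP; split; first by rewrite /Z /= -(subrr 0) fB subrr.
  by move=> a v w Zv Zw; rewrite /Z /= fglift_linear Zv Zw scaler0 addr0.
have /(smallest_sub ZS) Zr : multilin_rels `<=` Z.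
  move=> _ [x [i [a [v [w ->]]]]]; rewrite /Z /=.
  by rewrite fB fglift_linear !liftU !scale1r mf subrr.
by move=> /Zr; rewrite /Z /= fB => /eqP; rewrite subr_eq0 => /eqP.
Qed.

Lemma tlift_pure x : tlift f (tpure x) = f x.
Proof. by rewrite fglift_pi liftU scale1r. Qed.

Lemma tlift_linear a t u : tlift f (a *: t + u) = a *: tlift f t + tlift f u.
Proof.
have [x ->] := tens_surj t; have [y ->] := tens_surj u.
rewrite -[a *: \pi_tens _]/(tens_scale a _) -tens_piZ -tens_piD.
by rewrite !fglift_pi fglift_linear.
Qed.

Lemma tlift_unique (g : tens -> W) :
  (forall a t u, g (a *: t + u) = a *: g t + g u) ->
  (forall x, g (tpure x) = f x) -> g =1 tlift f.
Proof.
move=> gL gf; elim/tens_ind => [|a x t IHt]; last first.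
  by rewrite gL tlift_linear tlift_pure IHt gf.
have lin0 (h : tens -> W) :
    (forall a t u, h (a *: t + u) = a *: h t + h u) -> h 0 = 0.
  by move=> hL; have := hL (-1) 0 0; rewrite scaler0 addr0 scaleN1r addNr.
by rewrite !lin0 //; exact: tlift_linear.
Qed.

End Lift.

Lemma tlift_fun (W : lmodType K) (f g : vfam -> W) a t :
  tlift (fun x => a *: f x + g x) t = a *: tlift f t + tlift g t.
Proof.
rewrite /tlift; elim/freeg_ind: (repr t) => [|b x s IHs].
  have f0 (h : vfam -> W) : fglift h 0 = 0.
    by have := fglift_linear h (-1) 0 0; rewrite scaler0 addr0 scaleN1r addNr.
  by rewrite !f0 scaler0 addr0.
rewrite !fglift_linear IHs -[<< x >>]/(<< 1 *g x >>) !liftU !scale1r.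
rewrite !scalerDr !scalerA addrACA; congr (_ *: _ + _ + _).
by rewrite mulrC.
Qed.

End TensorProduct.

Section PartialTensors.
Variables (K : fieldType) (L : finType) (V : L -> lmodType K).
Implicit Types D : {set L}.

Definition subvfam D : Type := vfam (fun i : {l | l \in D} => V (val i)).

Definition ptens D : Type := tens (fun i : {l | l \in D} => V (val i)).

Definition ext0 D (x : subvfam D) (l : L) : V l :=
  match @idP (l \in D) with
  | ReflectT lD => x (exist _ l lD)
  | ReflectF _ => 0
  end.

Definition merge D1 D2 D (x : subvfam D1) (y : subvfam D2) : subvfam D :=
  fun i => if val i \in D1 then ext0 x (val i) else ext0 y (val i).

Arguments merge {D1 D2} D x y.

(* The canonical bilinear map, meaningful when [D] is the disjoint union of   *)
(* [D1] and [D2]: see [tmul_pure], [tmul_linearl] and [tmul_linearr].         *)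
Definition tmul D1 D2 D (t : ptens D1) (u : ptens D2) : ptens D :=
  tlift (fun x : subvfam D1 =>
    tlift (fun y : subvfam D2 => (tpure (merge D x y) : ptens D)) u) t.

Arguments tmul {D1 D2} D t u.

Definition subspace_tens D1 D2 D (U1 : set (ptens D1)) (U2 : set (ptens D2)) :
    set (ptens D) :=
  lspan [set t | exists u1 u2, [/\ U1 u1, U2 u2 & t = tmul D u1 u2]].

Arguments subspace_tens {D1 D2} D U1 U2.

Lemma ext0_in D (x : subvfam D) (i : {l | l \in D}) : ext0 x (val i) = x i.
Proof.
case: i => l lD; rewrite /ext0 /=; case: {-}_ / idP => // lD'.
by rewrite (bool_irrelevance lD' lD).
Qed.

Lemma ext0_out D (x : subvfam D) (i : {l | l \in D}) (v : V (val i)) l :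
  val i != l -> ext0 (dfwith x v) l = ext0 x l.
Proof.
move=> il; rewrite /ext0; case: {-}_ / idP => // lD.
by rewrite dfwith_out //; apply: contra_neq il => ->.
Qed.

Section TensorMul.
Variables D1 D2 D : {set L}.
Hypotheses (D12 : forall l, l \in D1 -> l \notin D2) (DU : D = D1 :|: D2).

Lemma merge_multilinearl (y : subvfam D2) :
  multilinear (fun x : subvfam D1 => tpure (merge D x y) : ptens D).
Proof.
move=> x i a u v.
have iD : val i \in D by rewrite DU inE (valP i).
pose j : {l | l \in D} := exist _ (val i) iD.
have E (w : V (val i)) :
    merge D (dfwith x w) y = dfwith (merge D x y) (w : V (val j)).
  apply: functional_extensionality_dep => k; case: dfwithP => [|{}k jk].
    by rewrite /merge (valP i) ext0_in dfwith_in.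
  by rewrite /merge ext0_out //; apply: contra_neq jk => /val_inj.
by rewrite !E; exact: tpure_multilinear.
Qed.

Lemma merge_multilinearr (x : subvfam D1) :
  multilinear (fun y : subvfam D2 => tpure (merge D x y) : ptens D).
Proof.
move=> y i a u v.
have iD : val i \in D by rewrite DU inE (valP i) orbT.
have iD1 : val i \in D1 = false.
  by apply/negbTE/negP => /D12; rewrite (valP i).
pose j : {l | l \in D} := exist _ (val i) iD.
have E (w : V (val i)) :
    merge D x (dfwith y w) = dfwith (merge D x y) (w : V (val j)).
  apply: functional_extensionality_dep => k; case: dfwithP => [|{}k jk].
    by rewrite /merge iD1 ext0_in dfwith_in.
  by rewrite /merge ext0_out //; apply: contra_neq jk => /val_inj.
by rewrite !E; exact: tpure_multilinear.
Qed.

Lemma tmul_linearr (t : ptens D1) (a : K) (u w : ptens D2) :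
  tmul D t (a *: u + w) = a *: tmul D t u + tmul D t w.
Proof.
rewrite /tmul -tlift_fun; congr (tlift _ t); apply/funext => x.
exact/tlift_linear/merge_multilinearr.
Qed.

Lemma tmul_linearl (u : ptens D2) (a : K) (t s : ptens D1) :
  tmul D (a *: t + s) u = a *: tmul D t u + tmul D s u.
Proof.
apply: tlift_linear => x i b v w; rewrite -tlift_fun.
by congr (tlift _ u); apply/funext => y; rewrite (merge_multilinearl y).
Qed.

Lemma tmul_pure (x : subvfam D1) (y : subvfam D2) :
  tmul D (tpure x) (tpure y) = tpure (merge D x y).
Proof.
rewrite /tmul tlift_pure ?(tlift_pure (merge_multilinearr _)) // => z i b v w.
by rewrite !(tlift_pure (merge_multilinearr _)) merge_multilinearl.
Qed.

End TensorMul.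

End PartialTensors.

Arguments merge {K L V D1 D2} D x y.
Arguments tmul {K L V D1 D2} D t u.
Arguments subspace_tens {K L V D1 D2} D U1 U2.

(* Plane full binary trees whose leaves carry labels in [L]. *)
Inductive btree (L : Type) : Type :=
| leaf of L
| node of btree L & btree L.

Section Trees.
Variable L : finType.
Implicit Types S : btree L.

Fixpoint leaves S : seq L :=
  match S with
  | leaf l => [:: l]
  | node S1 S2 => leaves S1 ++ leaves S2
  end.

(* [None] is the root of [node S1 S2], [Some (inl v)] and [Some (inr v)] are  *)
(* the vertices of its left and right subtrees.                               *)
Fixpoint vertex S : finType :=
  match S with
  | leaf _ => unit
  | node S1 S2 => option (vertex S1 + vertex S2)
  end.

Definition root_vertex S : vertex S :=
  match S with
  | leaf _ => tt
  | node _ _ => None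
  end.

Fixpoint subtree S : vertex S -> btree L :=
  match S return vertex S -> btree L with
  | leaf l => fun=> leaf l
  | node S1 S2 => fun v =>
      match v with
      | None => node S1 S2
      | Some (inl v1) => subtree v1
      | Some (inr v2) => subtree v2
      end
  end.

(* [children v v1 v2]: [v] is a node with left child [v1], right child [v2] *)
Inductive children : forall S, vertex S -> vertex S -> vertex S -> Prop :=
| children_root S1 S2 :
    @children (node S1 S2) None
      (Some (inl (root_vertex S1))) (Some (inr (root_vertex S2)))
| children_left S1 S2 (v v1 v2 : vertex S1) : children v v1 v2 ->
    @children (node S1 S2) (Some (inl v)) (Some (inl v1)) (Some (inl v2))
| children_right S1 S2 (v v1 v2 : vertex S2) : children v v1 v2 ->
    @children (node S1 S2) (Some (inr v)) (Some (inr v1)) (Some (inr v2)).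

Definition desc S (v : vertex S) : {set L} :=
  [set l in leaves (subtree v)]%SET.

Definition is_leaf S : bool := if S is leaf _ then true else false.

Fixpoint train_track S : bool :=
  match S with
  | leaf _ => true
  | node S1 S2 =>
      [&& is_leaf S1 || is_leaf S2, (size (leaves S2) <= size (leaves S1))%N,
          train_track S1 & train_track S2]
  end.

Lemma size_leaves_gt0 S : (0 < size (leaves S))%N.
Proof. by elim: S => //= S1 IH1 S2 _; rewrite size_cat ltn_addr. Qed.

Lemma train_track_node S1 S2 :
  train_track (node S1 S2) -> train_track S1 /\ is_leaf S2.
Proof.
case/and4P=> /orP[] S12 le21 tt1 _; split=> //.
case: S1 S12 le21 tt1 => // l _ /=.
case: S2 => // S2 S3; rewrite /= size_cat => le1 _.
have := leq_add (size_leaves_gt0 S2) (size_leaves_gt0 S3).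
by move/leq_trans/(_ le1).
Qed.

Lemma train_track_exists l s : exists2 S, train_track S & leaves S = l :: s.
Proof.
elim/last_ind: s => [|s y [S ttS lS]]; first by exists (leaf l).
exists (node S (leaf y)); last by rewrite /= lS cats1.
by rewrite /= ttS orbT size_leaves_gt0.
Qed.

Lemma train_track_unique S S' :
  train_track S -> train_track S' -> leaves S = leaves S' -> S = S'.
Proof.
elim: S S' => [l|S1 IH1 S2 _] [l'|S1' S2'] //.
- by move=> _ _ [->].
- move=> _ _ /(congr1 size) /= /esym/eqP; rewrite size_cat.
  by case: (leaves S1') (size_leaves_gt0 S1') => //= ? [|? ?];
     case: (leaves S2') (size_leaves_gt0 S2').
- move=> _ _ /(congr1 size) /= /eqP; rewrite size_cat.
  by case: (leaves S1) (size_leaves_gt0 S1) => //= ? [|? ?];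
     case: (leaves S2) (size_leaves_gt0 S2).
move=> /train_track_node[tt1]; case: S2 => // y _.
move=> /train_track_node[tt1']; case: S2' => // y' _ /=.
by rewrite !cats1 => /rcons_inj[/(IH1 _ tt1 tt1') -> ->].
Qed.

End Trees.

Section TensorNetworks.
Variables (R : realType) (K : fieldType) (L : finType).

(* The full tensor product is indexed by [[set: L]]; [e] identifies this set  *)
(* with the set of all leaves of [S].                                         *)
Definition TNS (S : btree L) (V : L -> lmodType K) (g : vertex S -> R) :
    set (ptens V [set: L]) :=
  [set t | exists U : forall v : vertex S, set (ptens V (desc v)),
    [/\ forall v, subspace (U v) /\ dim_le (U v) (g v),
        exists e : [set: L]%SET = desc (root_vertex S),
          U (root_vertex S) (ecast D (ptens V D) e t)
      & forall v v1 v2, children v v1 v2 ->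
          U v `<=` subspace_tens (desc v) (U v1) (U v2)]].

Arguments TNS : clear implicits.

Definition tn_exponent (S S' : btree L) (e : R) : Prop :=
  0 < e /\
  forall (f : vertex S -> nat) (f' : vertex S' -> nat),
    (forall v, (0 < f v)%N) -> (forall v, (0 < f' v)%N) ->
  forall c : R, e < c ->
  exists r0 : nat, forall (V : L -> lmodType K) (r : R), r0%:R <= r ->
    TNS S V (fun v => r * (f v)%:R) `<=` TNS S' V (fun v => r `^ c * (f' v)%:R).

End TensorNetworks.

(* Main.v *)
(* A tensor in the train track format with bond dimension [N] is a product of *)
(* matrices [A_l] with entries in [V_l].  The partial product of these        *)
(* matrices over an interval of leaves does not depend on the bracketing, so  *)
(* it can be computed along the tree [T]; the span of its [N * N] entries is  *)
(* the space attached to the corresponding vertex of [T].  With [N] of order  *)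
(* [r * F] for a constant [F], and [c > 2], one has [(r * F) ^ 2 <= r ^ c]    *)
(* once [r] is large.                                                         *)
Require Import Defs.
From mathcomp Require Import all_boot all_order all_algebra.
From mathcomp Require Import boolp classical_sets reals exp.

Set Implicit Arguments.
Unset Strict Implicit.
Unset Printing Implicit Defensive.

Import Order.TTheory GRing.Theory Num.Theory.
Local Open Scope classical_set_scope.
Local Open Scope ring_scope.

(** Every right child in [TT] is a leaf, so the spaces of the network can be processed from left to
    right. Expanding the spanning vectors of a node over those of its left child gives coefficients
    at the leaf on the right, and these are the entries of a matrix [A l]. By [train_track_cores]
    the root space lies in the span of the entries of a row of ones times the product of all [A l].
    Associativity of that product ([train_vec_tree]) regroups it along [T], where a vertex carries a
    matrix indexed by two bonds; hence the exponent 2. The spans of the entries are nested as [TNS]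
    requires ([tree_prod_nested]), and [exp_dominates] absorbs the constants. *)

(** * Spans of finite families and their dimension *)

Section LinearSpans.
Variables (K : fieldType) (M : lmodType K).
Implicit Types (U : set M).

Lemma lspan_sub (S U : set M) : subspace U -> S `<=` U -> lspan S `<=` U.
Proof. exact: smallest_sub. Qed.

Lemma sub_lspan (S : set M) : S `<=` lspan S.
Proof. exact: sub_gen_smallest. Qed.

Lemma subspace_scale U a x : subspace U -> U x -> U (a *: x).
Proof. by case/subspaceP=> U0 UD Ux; rewrite -[_ *: _]addr0; apply: UD. Qed.

Lemma subspace_sum U (I : finType) (F : I -> M) :
  subspace U -> (forall i, U (F i)) -> U (\sum_i F i).
Proof.
case/subspaceP=> U0 UD UF; elim/big_ind: _ => // x y Ux Uy.
by rewrite -[x]scale1r; apply: UD.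
Qed.

Lemma lspan_rangeP (I : finType) (b : I -> M) x :
  lspan (range b) x <-> exists c : I -> K, x = \sum_i c i *: b i.
Proof.
split=> [|[c ->]]; last first.
  apply: (subspace_sum (lspan_subspace _)) => i.
  apply: (subspace_scale _ (lspan_subspace _)).
  by apply: sub_lspan; exists i.
apply: (@lspan_sub _ [set y | exists c : I -> K, y = \sum_i c i *: b i])
  => [|_ [i _ <-]].
  apply/subspaceP; split=> [|a _ _ [c ->] [c' ->]].
    by exists (fun=> 0); rewrite big1 // => i _; rewrite scale0r.
  exists (fun i => a * c i + c' i); rewrite scaler_sumr -big_split.
  by apply: eq_bigr => i _; rewrite scalerDl scalerA.
exists (fun j => (j == i)%:R).
rewrite (bigD1 i) //= eqxx scale1r big1 ?addr0 // => j /negbTE ->.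
by rewrite scale0r.
Qed.

(** A nontrivial relation allows one vector to be dropped without changing the span, so induction on
    [m] ends at an independent family. *)
Lemma lspan_range_has_dim m (b : 'I_m -> M) :
  exists2 d, (d <= m)%N & has_dim (lspan (range b)) d.
Proof.
elim: m b => [|m IHm] b; first by exists 0 => //; exists b => // c _ [].
have [indb|] := pselect (lin_indep b); first by exists m.+1 => //; exists b.
move=> /existsNP[c /not_implyP[cb0 /existsNP[i0 /eqP ci0]]].
have [d dm bd] := IHm (b \o lift i0); exists d; first exact: leqW.
suff -> : lspan (range b) = lspan (range (b \o lift i0)) by [].
rewrite eqEsubset; split; apply: (lspan_sub (lspan_subspace _)); last first.
  by move=> _ [i _ <-]; apply: sub_lspan; exists (lift i0 i).
move=> _ [i _ <-]; case: (unliftP i0 i) => [j ->|->].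
  by apply: sub_lspan; exists j.
apply/lspan_rangeP; exists (fun j => - ((c i0)^-1 * c (lift i0 j))).
move: cb0; rewrite (bigD1_ord i0) //= => /eqP; rewrite addr_eq0 => /eqP.
move/(congr1 (fun y => (c i0)^-1 *: y)); rewrite scalerA mulVf // scale1r => ->.
rewrite scalerN scaler_sumr -sumrN; apply: eq_bigr => j _.
by rewrite scalerA scaleNr.
Qed.

Lemma dim_le_lspan_range (R : realType) (I : finType) (b : I -> M) (g : R) :
  #|I|%:R <= g -> dim_le (lspan (range b)) g.
Proof.
move=> Ig.
have [d dI bd] := lspan_range_has_dim (b \o (enum_val : 'I_#|I| -> I)).
exists d; last by apply: le_trans Ig; rewrite ler_nat.
suff -> : range b = range (b \o (enum_val : 'I_#|I| -> I)) by [].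
rewrite eqEsubset; split=> _ [i _ <-]; last by exists (enum_val i).
by exists (enum_rank i) => //=; rewrite enum_rankK.
Qed.

(** A basis is padded with zero vectors, so that all bonds share one index type and all cores become
    square matrices of one size. *)
Lemma has_dim_range U d N : has_dim U d -> (d <= N)%N ->
  exists b : 'I_N -> M, U = lspan (range b).
Proof.
move=> [b _ <-] dN.
exists (fun i => if insub (val i) is Some j then b j else 0).
rewrite eqEsubset; split; apply: (lspan_sub (lspan_subspace _)).
  move=> _ [i _ <-]; apply: sub_lspan; exists (widen_ord dN i) => //=.
  by rewrite insubT //= => ilt; congr b; apply: val_inj.
move=> _ [i _ <-]; case: insubP => [j _ _|_].
  by apply: sub_lspan; exists j.
by have /subspaceP[] := lspan_subspace (range b).
Qed.

End LinearSpans.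

(** * Maps given only by a linearity equation *)

Section LinearMaps.
Variables (K : fieldType) (M W : lmodType K) (h : M -> W).
Hypothesis hL : forall a x y, h (a *: x + y) = a *: h x + h y.

Lemma linear_map0 : h 0 = 0.
Proof. by have := hL (-1) 0 0; rewrite scaler0 addr0 scaleN1r addNr. Qed.

Lemma linear_mapZ a x : h (a *: x) = a *: h x.
Proof. by rewrite -[a *: x]addr0 hL linear_map0 addr0. Qed.

Lemma linear_map_sum (I : finType) (F : I -> M) :
  h (\sum_i F i) = \sum_i h (F i).
Proof.
apply: (big_morph h) => [x y|]; last exact: linear_map0.
by rewrite -[x in LHS]scale1r hL scale1r.
Qed.

End LinearMaps.

Lemma tens_linear_ext (K : fieldType) (I : finType) (V : I -> lmodType K)
    (W : lmodType K) (h g : tens V -> W) :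
  (forall a t u, h (a *: t + u) = a *: h t + h u) ->
  (forall a t u, g (a *: t + u) = a *: g t + g u) ->
  (forall x, h (tpure x) = g (tpure x)) -> h =1 g.
Proof.
move=> hL gL hg; elim/tens_ind => [|a x t IH]; first by rewrite !linear_map0.
by rewrite hL gL hg IH.
Qed.

(** * Associativity and unit of the tensor multiplication *)

Section TensorMultiplication.
Variables (K : fieldType) (L : finType) (V : L -> lmodType K).
Implicit Types D : {set L}.

Lemma ext0_merge D1 D2 D (x : subvfam V D1) (y : subvfam V D2) l :
  l \in D ->
  ext0 (Defs.merge D x y) l = if l \in D1 then ext0 x l else ext0 y l.
Proof. by move=> lD; rewrite (ext0_in _ (exist _ l lD)). Qed.

Lemma tmulZl D1 D2 D a (t : ptens V D1) (u : ptens V D2) :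
  D = (D1 :|: D2)%SET -> tmul D (a *: t) u = a *: tmul D t u.
Proof.
by move=> e; apply: (linear_mapZ (h := fun t => tmul D t u)) => b x y;
  rewrite (tmul_linearl e).
Qed.

Lemma tmulZr D1 D2 D a (t : ptens V D1) (u : ptens V D2) :
  (forall l, l \in D1 -> l \notin D2) -> D = (D1 :|: D2)%SET ->
  tmul D t (a *: u) = a *: tmul D t u.
Proof.
by move=> d e; apply: (linear_mapZ (h := tmul D t)); apply: tmul_linearr.
Qed.

Lemma tmul_suml D1 D2 D (I : finType) (t : I -> ptens V D1) (u : ptens V D2) :
  D = (D1 :|: D2)%SET -> tmul D (\sum_i t i) u = \sum_i tmul D (t i) u.
Proof.
by move=> e; apply: (linear_map_sum (h := fun t => tmul D t u)) => a x y;
  rewrite (tmul_linearl e).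
Qed.

Lemma tmul_sumr D1 D2 D (I : finType) (t : ptens V D1) (u : I -> ptens V D2) :
  (forall l, l \in D1 -> l \notin D2) -> D = (D1 :|: D2)%SET ->
  tmul D t (\sum_i u i) = \sum_i tmul D t (u i).
Proof.
by move=> d e; apply: (linear_map_sum (h := tmul D t)); apply: tmul_linearr.
Qed.

(** Both sides are linear in each argument, which reduces the claim to pure tensors; there both
    merges take each coordinate from the same family. Index sets are related by equations so that no
    cast appears. *)
Lemma tmulA D1 D2 D3 D12 D23 D (x : ptens V D1) (y : ptens V D2)
    (z : ptens V D3) :
  (forall l, l \in D1 -> l \notin D2) -> (forall l, l \in D12 -> l \notin D3) ->
  D12 = D1 :|: D2 -> D23 = D2 :|: D3 -> D = D12 :|: D3 ->
  tmul D (tmul D12 x y) z = tmul D x (tmul D23 y z).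
Proof.
move=> d12 d3 e12 e23 e.
have d23 l : l \in D2 -> l \notin D3.
  by move=> lD2; apply: d3; rewrite e12 inE lD2 orbT.
have d1 l : l \in D1 -> l \notin D23.
  move=> lD1; rewrite e23 inE negb_or d12 //=.
  by apply: d3; rewrite e12 inE lD1.
have e' : D = D1 :|: D23 by rewrite e e12 e23 finset.setUA.
pose rr := (tmul_linearr d12 e12, tmul_linearr d23 e23, tmul_linearr d3 e,
            tmul_linearr d1 e').
pose ll := (tmul_linearl e12, tmul_linearl e23, tmul_linearl e,
            tmul_linearl e').
move: x; apply: tens_linear_ext => [a t u|a t u|x]; rewrite ?ll //.
move: y; apply: tens_linear_ext => [a t u|a t u|y]; rewrite ?(rr, ll) //.
move: z; apply: tens_linear_ext => [a t u|a t u|z]; rewrite ?rr //.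
rewrite (tmul_pure d12 e12) (tmul_pure d23 e23) (tmul_pure d3 e).
rewrite (tmul_pure d1 e').
congr tpure; apply: functional_extensionality_dep => -[l lD].
rewrite /Defs.merge /=.
have : l \in D by []; rewrite e' inE.
have -> : (l \in D12) = (l \in D1) || (l \in D2) by rewrite e12 inE.
case lD1: (l \in D1) => /=; first by rewrite ext0_merge ?lD1 // e12 inE lD1.
move=> lD23; rewrite [in RHS]ext0_merge //; case lD2: (l \in D2) => //.
by rewrite ext0_merge ?lD1 // e12 inE lD2 orbT.
Qed.

(** Over the empty index set a family has no coordinates to contribute. This makes the initial
    tensor of [train_vec] a unit. *)
Lemma tmul1 D1 D (x : subvfam V D1) (y : ptens V D) :
  D1 = finset.set0 -> tmul D (tpure x : ptens V D1) y = y.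
Proof.
move=> D1E.
have d l : l \in D1 -> l \notin D by rewrite D1E inE.
have e : D = D1 :|: D by rewrite D1E finset.set0U.
move: y; apply: tens_linear_ext => [a t u|//|y]; first exact: tmul_linearr.
rewrite (tmul_pure d e); congr tpure; apply: functional_extensionality_dep => i.
by rewrite /Defs.merge {1}D1E inE ext0_in.
Qed.

End TensorMultiplication.

(** * Products of cores along a tree and along a line *)

Section CoreProducts.
Variables (K : fieldType) (L : finType) (V : L -> lmodType K) (N : nat).
Implicit Types (S : btree L) (q : seq L).

(** The index set has the form to which [[set x in leaves (leaf l)]] reduces, so [tree_prod] needs
    no cast at a leaf. *)
Definition cores : Type :=
  forall l, 'I_N -> 'I_N -> ptens V [set x in [:: l]]%SET.

Definition set_core (A : cores) l B : cores := @dfwith L _ A l B.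

Fixpoint tree_prod (A : cores) S :
    'I_N -> 'I_N -> ptens V [set x in leaves S]%SET :=
  match S return 'I_N -> 'I_N -> ptens V [set x in leaves S]%SET with
  | leaf l => A l
  | node S1 S2 => fun i j =>
      \sum_k tmul _ (tree_prod A S1 i k) (tree_prod A S2 k j)
  end.

(* The row vector of ones times the matrices [A l]; [q] lists the leaves from *)
(* right to left.  The index set [D] is meant to be [[set x in q]]; leaving   *)
(* it free avoids casts between equal index sets.                             *)
Fixpoint train_vec (A : cores) q D : 'I_N -> ptens V D :=
  if q is l :: q' then fun j =>
    \sum_k tmul D (train_vec A q' [set x in q']%SET k) (A l k j)
  else fun=> tpure (fun=> 0).

(** Associativity of the matrix product. The list [q] holds the leaves already multiplied; keeping
    it general lets the leaves of the left subtree join it before the right subtree is treated. *)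
Lemma train_vec_tree A S q D j :
  uniq (catrev (leaves S) q) -> D = [set x in catrev (leaves S) q]%SET ->
  train_vec A (catrev (leaves S) q) D j =
  \sum_i tmul D (train_vec A q [set x in q]%SET i) (tree_prod A S i j).
Proof.
elim: S q D j => [l|S1 IH1 S2 IH2] q D j //=.
rewrite catrev_catl => uq DE.
have uq1 : uniq (catrev (leaves S1) q).
  by move: uq; rewrite catrevE cat_uniq => /and3P[].
have dis2 l : l \in [set x in catrev (leaves S1) q]%SET ->
    l \notin [set x in leaves S2]%SET.
  move: uq; rewrite catrevE cat_uniq => /and3P[_ /hasPn dis _].
  by rewrite !inE => /dis; rewrite /= mem_rev.
have dis1 l : l \in [set x in q]%SET -> l \notin [set x in leaves S1]%SET.
  move: uq1; rewrite catrevE cat_uniq => /and3P[_ /hasPn dis _].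
  by rewrite !inE => /dis; rewrite /= mem_rev.
have E1 : [set x in catrev (leaves S1) q]%SET =
    ([set x in q] :|: [set x in leaves S1])%SET.
  by apply/setP => l; rewrite !inE catrevE mem_cat mem_rev orbC.
have E12 : [set x in leaves S1 ++ leaves S2]%SET =
    ([set x in leaves S1] :|: [set x in leaves S2])%SET.
  by apply/setP => l; rewrite !inE mem_cat.
have E : D = ([set x in catrev (leaves S1) q] :|: [set x in leaves S2])%SET.
  by rewrite DE; apply/setP => l; rewrite !inE catrevE mem_cat mem_rev orbC.
have dq l : l \in [set x in q]%SET ->
    l \notin [set x in leaves S1 ++ leaves S2]%SET.
  by move=> lq; rewrite E12 inE negb_or dis1 //= dis2 // E1 inE lq.
have E' : D = ([set x in q] :|: [set x in leaves S1 ++ leaves S2])%SET.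
  by rewrite E E1 E12 finset.setUA.
rewrite IH2 //.
(* The common double sum: [i] is the bond before [S1] and [k] the bond between [S1] and [S2]. *)
transitivity (\sum_k \sum_i tmul D (train_vec A q [set x in q]%SET i)
    (tmul [set x in leaves S1 ++ leaves S2]%SET
       (tree_prod A S1 i k) (tree_prod A S2 k j))).
  apply: eq_bigr => k _; rewrite IH1 // (tmul_suml _ _ E).
  by apply: eq_bigr => i _; rewrite (tmulA _ _ _ dis1 dis2 E1 E12 E).
by rewrite exchange_big; apply: eq_bigr => i _; rewrite (tmul_sumr _ _ dq E').
Qed.

Lemma train_vec_nil A D (y : ptens V D) i :
  tmul D (train_vec A [::] [set x in [::]]%SET i) y = y.
Proof. exact: tmul1. Qed.

Lemma train_vec_leaves A S j : uniq (leaves S) ->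
  train_vec A (rev (leaves S)) [set x in leaves S]%SET j =
  \sum_i tree_prod A S i j.
Proof.
move=> uS; rewrite /rev train_vec_tree; last 2 first.
- by rewrite -/(rev _) rev_uniq.
- by apply/setP => l; rewrite -/(rev _) !inE mem_rev.
by apply: eq_bigr => i _; rewrite train_vec_nil.
Qed.

Lemma eq_train_vec A A' q D j :
  (forall l, l \in q -> A l = A' l) -> train_vec A q D j = train_vec A' q D j.
Proof.
elim: q D j => //= l q IH D j AA'; apply: eq_bigr => k _.
rewrite AA' ?mem_head // IH // => l' l'q; apply: AA'.
by rewrite inE l'q orbT.
Qed.

Lemma tmul_train_vec A q D1 D2 D D' k (y : ptens V D') : D1 = D2 ->
  tmul D (train_vec A q D1 k) y = tmul D (train_vec A q D2 k) y.
Proof. by move->. Qed.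

(** Transports membership between the root index sets of two trees, which are equal but need not be
    convertible. *)
Lemma ecast_train_vec A q D0 D D' (e : D0 = D) (e' : D0 = D') (t : ptens V D0) :
  lspan (range (train_vec A q D)) (ecast X (ptens V X) e t) ->
  lspan (range (train_vec A q D')) (ecast X (ptens V X) e' t).
Proof. by move: e e'; do 2 (case: _ /). Qed.

End CoreProducts.

Arguments set_core {K L V N} A {l} B.
Arguments tree_prod {K L V N} A S.
Arguments train_vec {K L V N} A q D.

Lemma desc_root (L : finType) (S : btree L) :
  desc (root_vertex S) = [set x in leaves S]%SET.
Proof. by rewrite /desc; case: S. Qed.

(** * From nested spaces on the train track to cores, and from cores to nested spaces on any tree *)

Section TrainTrackCores.
Variables (K : fieldType) (L : finType) (V : L -> lmodType K).

(** Induction along the left spine, adding one core for the rightmost leaf at each node. The size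
    [N.+1] guarantees an index [ord0] for the core of the leftmost leaf. *)
Lemma train_track_cores N (S : btree L)
    (U : forall v : vertex S, set (ptens V (desc v))) :
  train_track S -> uniq (leaves S) ->
  (forall v, exists2 d, has_dim (U v) d & (d <= N.+1)%N) ->
  (forall v v1 v2, children v v1 v2 ->
     U v `<=` subspace_tens (desc v) (U v1) (U v2)) ->
  exists A : cores V N.+1, U (root_vertex S) `<=`
    lspan (range (train_vec A (rev (leaves S)) (desc (root_vertex S)))).
Proof.
elim: S U => [l|S1 IH S2 _] U ttS uS dimU nestU.
  have [d Ud dN] := dimU tt; have [b ->] := has_dim_range Ud dN.
  (* Only the first row is nonzero, so the row of ones times this matrix has entries [b j]. *)
  have [A AE] : exists A : cores V N.+1, A l = fun i j => (i == ord0)%:R *: b j.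
    exists (set_core (fun=> fun=> fun=> 0) (l := l)
              (fun i j => (i == ord0)%:R *: b j)).
    exact: dfwith_in.
  exists A; apply: (lspan_sub (lspan_subspace _)).
  move=> _ [j _ <-]; apply: sub_lspan; exists j => //.
  rewrite (train_vec_leaves A) //= AE -scaler_suml (bigD1 ord0) //=.
  by rewrite big1 ?addr0 ?scale1r // => i /negbTE ->.
have [ttS1] := train_track_node ttS.
case: S2 => // l in U ttS uS dimU nestU * => _.
have uS1 : uniq (leaves S1) by move: uS; rewrite /= cat_uniq => /and3P[].
have lS1 : l \notin leaves S1.
  by move: uS; rewrite /= cats1 rcons_uniq => /andP[].
have [||A0 UA0] := IH (fun v => U (Some (inl v))) ttS1 uS1.
- by move=> v; exact: (dimU (Some (inl v))).
- by move=> v v1 v2 vv; exact: (nestU _ _ _ (children_left (leaf l) vv)).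
have [d Ud dN] := dimU None; have [b UE] := has_dim_range Ud dN.
set D := desc (None : vertex (node S1 (leaf l))) in b UE *.
set D1 := desc (root_vertex S1) in UA0.
have D1E : D1 = [set x in leaves S1]%SET by exact: desc_root.
have disj x : x \in D1 -> x \notin [set x in [:: l]]%SET.
  by rewrite D1E !inE; apply: contraTneq => ->.
have DE : D = (D1 :|: [set x in [:: l]])%SET.
  by rewrite D1E; apply/setP => x; rewrite !inE /= mem_cat inE.
have tmulE j : exists a : 'I_N.+1 -> ptens V [set x in [:: l]]%SET,
    b j = \sum_k tmul D (train_vec A0 (rev (leaves S1)) D1 k) (a k).
  have : U None (b j) by rewrite UE; apply: sub_lspan; exists j.
  move/(nestU _ _ _ (children_root S1 (leaf l))).
  (* Sums of this shape form a subspace, so it suffices to treat products of vectors from the two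
     child spaces. *)
  apply: (@lspan_sub _ _ _ [set x | exists a, x = \sum_k tmul D _ (a k)]).
    apply/subspaceP; split=> [|c _ _ [a ->] [a' ->]].
      exists (fun=> 0); rewrite big1 // => k _.
      exact/linear_map0/tmul_linearr.
    exists (fun k => c *: a k + a' k); rewrite scaler_sumr -big_split.
    by apply: eq_bigr => k _; rewrite (tmul_linearr disj DE).
  move=> _ [x [y [/UA0 /lspan_rangeP[c ->] _ ->]]]; exists (fun k => c k *: y).
  rewrite (tmul_suml _ _ DE); apply: eq_bigr => k _.
  by rewrite (tmulZl _ _ _ DE) (tmulZr _ _ _ disj DE).
have [a aE] := choice tmulE.
(* Column [j] of the new core holds the coefficients of [b j]. The earlier cores are unaffected, as
   [l] is not a leaf of [S1]. *)
exists (set_core A0 (fun i j => a j i)).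
rewrite /= UE; apply: (lspan_sub (lspan_subspace _)).
move=> _ [j _ <-]; apply: sub_lspan; exists j => //.
rewrite cats1 rev_rcons /= aE; apply: eq_bigr => k _.
rewrite /set_core dfwith_in (@tmul_train_vec _ _ _ _ _ _ _ D1); last first.
  by rewrite D1E; apply/setP => x; rewrite !inE mem_rev.
congr tmul; apply: eq_train_vec => x; rewrite mem_rev => xS1.
by rewrite dfwith_out //; apply: contraNneq lS1 => ->.
Qed.

(** The matrix product formula writes each entry at a node as a sum of products of entries at its
    two children. *)
Lemma tree_prod_nested N (A : cores V N) S (v v1 v2 : vertex S) :
  children v v1 v2 ->
  let W v := lspan (range (fun ij : 'I_N * 'I_N =>
                tree_prod A (subtree v) ij.1 ij.2)) in
  W v `<=` subspace_tens (desc v) (W v1) (W v2).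
Proof.
elim=> {S v v1 v2} [S1 S2|//|//] /=.
apply: (lspan_sub (lspan_subspace _)).
move=> _ [[i j] _ <-] /=.
apply: (subspace_sum (lspan_subspace _)) => k.
apply: sub_lspan.
have TS S i' j' : lspan (range (fun ij : 'I_N * 'I_N =>
    tree_prod A S ij.1 ij.2)) (tree_prod A S i' j').
  by apply: sub_lspan; exists (i', j').
(* [subtree (root_vertex S)] reduces to [S] only once [S] is a constructor. *)
case: S1 S2 => [l1|S11 S12] [l2|S21 S22]; (do 2 eexists;
  split; [exact: (TS _ i k) | exact: (TS _ k j) | reflexivity]).
Qed.

End TrainTrackCores.

(** * Growth estimate and conclusion *)

Lemma exp_dominates (R : realType) (F c : R) : 2 < c -> 1 <= F ->
  exists r0 : nat, forall r, r0%:R <= r -> 1 <= r /\ (r * F) ^+ 2 <= r `^ c.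
Proof.
(* The threshold [x] solves [x ^ (c - 2) = F ^ 2]; beyond it, the factor of exponent [c - 2] left
   after splitting off [r ^ 2] dominates [F ^ 2]. *)
move=> c2 F1; pose x := F `^ (2 / (c - 2)).
have c20 : 0 < c - 2 by rewrite subr_gt0.
exists (Num.truncn x).+1 => r r0r.
have r1 : 1 <= r by apply: le_trans r0r; rewrite ler1n.
have r0 : 0 < r by apply: lt_le_trans r1.
have xr : x <= r by apply: le_trans r0r; apply/ltW/truncnS_gt.
split=> //; rewrite exprMn.
have -> : c = 2%:R + (c - 2) by rewrite addrC subrK.
rewrite powRD; last by rewrite (gt_eqF r0) implybT.
rewrite powR_mulrn ?(ltW r0) // ler_pM2l ?exprn_gt0 //.
have -> : F ^+ 2 = x `^ (c - 2).
  rewrite /x -powRrM mulrVK ?unitfE ?gt_eqF // powR_mulrn //.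
  exact: le_trans F1.
by apply: ge0_ler_powR => //; rewrite ?nnegrE ?powR_ge0 //; apply: ltW.
Qed.

Theorem theorem4p6 (R : realType) (K : fieldType) (n : nat)
    (T TT : btree 'I_n)
    (leavesT : leaves T = enum 'I_n)
    (train_track_TT : train_track TT) (leavesTT : leaves TT = enum 'I_n) :
  tn_exponent K TT T (2%:R : R)%R.
Proof.
split=> [|f f' f_gt0 f'_gt0 c c2]; first by rewrite ltr0n.
(* A uniform bound for all [f v], so that one bond size serves every vertex. *)
pose F : nat := (\sum_v f v)%N.
(* The successor leaves room for the extra bond index: [N + 1 <= r * F + 1 <= r * (F + 1)], since
   [r >= 1]. *)
have [|r0 r0P] := @exp_dominates R F.+1%:R c c2; first by rewrite ler1n.
exists r0 => V r /r0P[r1 rF] t [U [dimU [e Ut] nestU]].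
have r_ge0 : 0 <= r by apply: le_trans r1.
pose N := Num.truncn (r * F%:R).
have Nr : N.+1%:R <= r * F.+1%:R.
  by rewrite -!natr1 mulrDr mulr1 lerD // truncn_le // mulr_ge0.
have uTT : uniq (leaves TT) by rewrite leavesTT enum_uniq.
have [|A UA] := @train_track_cores _ _ V N TT U train_track_TT uTT _ nestU.
  move=> v; have [_ [d Ud dle]] := dimU v; exists d => //.
  rewrite leqW // truncn_ge_nat ?mulr_ge0 //; apply: (le_trans dle).
  by rewrite ler_wpM2l // ler_nat /F (bigD1 v) //= leq_addr.
exists (fun v => lspan (range (fun ij => tree_prod A (subtree v) ij.1 ij.2))).
split=> [v||v v1 v2]; last exact: tree_prod_nested.
  split; first exact: lspan_subspace.
  apply: dim_le_lspan_range; rewrite card_prod card_ord natrM.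
  apply: (@le_trans _ _ (r `^ c)); last by rewrite ler_peMr ?powR_ge0 ?ler1n.
  by apply: le_trans rF; rewrite expr2 ler_pM.
have e' : [set: 'I_n]%SET = desc (root_vertex T).
  by rewrite desc_root leavesT; apply/setP => x; rewrite !inE mem_enum.
(* Both trees list the leaves in the same order, so the row vector obtained from [TT] is also the
   one belonging to [T]. *)
exists e'; move/UA: Ut; rewrite leavesTT -leavesT => /(ecast_train_vec e').
move=> /lspan_rangeP[c' ->].
have uT : uniq (leaves T) by rewrite leavesT enum_uniq.
apply: (subspace_sum (lspan_subspace _)) => j.
apply: (subspace_scale _ (lspan_subspace _)).
(* The row of ones sums each column of the matrix at the root of [T], which stays in the span of its
   entries. *)
have -> : train_vec A (rev (leaves T)) (desc (root_vertex T)) j =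
    \sum_i tree_prod A (subtree (root_vertex T)) i j.
  by case: (T) uT => [l|T1 T2] uT; exact: train_vec_leaves.
apply: (subspace_sum (lspan_subspace _)) => i.
by apply: sub_lspan; exists (i, j).
Qed.
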